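(* For $(a,b,m,n)\in\mathcal{Q}$ and $F,G\in\mathbb{C}[x,y]$ consider the conditions (1) $N^0(F)=T_{m,n}$ and $N^0(F-x^my^n)\subsetneq N^0(F)$; (2) $F^{(0,1)}_{n-i}$ is divisible by $(x+1)^{m-i}$ for $0\le i\le m$; (3) $F^{(1,1)}_{m+n-i}$ is divisible by $(x+y)^{n-i}$ for $0\le i\le n$; (4) $N^0(G)=T_{bm/a,bn/a}$ and $N^0(G-x^{bm/a}y^{bn/a})\subsetneq N^0(G)$; (5) $[F,G]\in\mathbb{C}$. Consider the following two assertions. **Assertion D.** For all $(a,b,m,n)\in\mathcal{Q}$ and all $F,G\in\mathbb{C}[x,y]$ satisfying (1)–(5), the following hold: (i) Let $w=(0,1)$ and let $i$ be an integer in $[m(n-m)\frac{a-1}{a}+1,\,m(n-m)]$. If $F^\circ$ satisfies the $i$-th collection of $w$-DC, then $F^\circ$ satisfies the $(i-1)$-th collection of $w$-DC. (ii) Let $w=(1,1)$ and let $i$ be an integer in $[m(n-m)\frac{a-1}{a},\,m(n-m)]$. If $F^\circ$ satisfies the $i$-th collection of $w$-DC, then $F^\circ$ satisfies the $(i-1)$-th collection of $w$-DC. (iii) Let $i$ be an integer in $[1,\,m(n-m)\frac{a-1}{a}]$. If $F^\circ$ satisfies the $i$-th collection of DSC, then $F^\circ$ satisfies the $(i-1)$-th collection of DC. **Assertion C.** For all $(a,b,m,n)\in\mathcal{Q}$ and all $F,G\in\mathbb{C}[x,y]$ satisfying (1)–(5), any of the following equivalent statements is true: (i) $\emptyset\in\mathbb{V}_F$;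 (ii) there is $\alpha\in\mathbb{T}$ such that $F-\alpha(E^\circ)=0$; (iii) $V^\circ=\emptyset$; (iv) $F^\circ=0$. If Assertion D is true, then Assertion C is true.
   Context: For $f,g\in\mathbb{C}[x,y]$, $[f,g]=\frac{\partial f}{\partial x}\frac{\partial g}{\partial y}-\frac{\partial g}{\partial x}\frac{\partial f}{\partial y}$. For $f=\sum f_{ij}x^iy^j\in\mathbb{C}[x,y]$, $\mathrm{supp}(f)=\{(i,j):f_{ij}\neq0\}\subset\mathbb{R}^2$; for $f\ne0$, $N^0(f)$ is the convex hull of $\mathrm{supp}(f)\cup\{(0,0)\}$, and $N^0(0)=\emptyset$. For integers $m,n$, $T_{m,n}=\{(x,y)\in\mathbb{R}^2: 0\le y\le n,\ 0\le x\le m+n-y\}$ (empty if $n<0$). $\mathcal{Q}=\{(a,b,m,n)\in\mathbb{Z}_{>0}^4: m<n,\ a\mid m,\ a\mid n,\ \gcd(a,b)=1,\ 2\le a<b\}$. $f^{(0,1)}_j$ is the sum of the terms of $f$ of $y$-degree $j$ and $f^{(1,1)}_j$ the sum of the terms of total degree $j$. $\mathbb{T}$ is the set of polynomials $\alpha(z)=z^k+e_{k-1}z^{k-1}+\dots+e_0\in\mathbb{C}[z]$ with $k\ge1$ and $e_{k-1}=0$. For $f\in\mathbb{C}[x,y]$, $\mathcal{E}(f)=\{E\in\mathbb{C}[x,y]: f=\alpha(E)\text{ for some }\alpha\in\mathbb{T}\}$; $f$ is called principal if $\mathcal{E}(f)=\{f\}$. Let $(a,b,m,n)\in\mathcal{Q}$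 and let $F$ satisfy (1)–(3). Put $\mathcal{N}'=\frac1aT_{m,n}$ and $\mathcal{N}''=\mathcal{N}'+\frac{a-1}{a}(m,n)$. There is a unique polynomial $Q\in\mathbb{C}[x,y]$ with $N^0(Q-x^{m/a}y^{n/a})\subsetneq N^0(Q)=\mathcal{N}'$ and $\mathrm{supp}(F-Q^a)\subseteq N^0(F)\setminus\mathcal{N}''$. There is a unique $\delta\in\mathbb{Z}_{>0}$ such that $N^0(E)=\frac{1}{\delta a}T_{m,n}$ for every principal polynomial $E\in\mathcal{E}(Q)$. $E^\circ$ (the $F$-generator) is the unique principal polynomial in $\mathcal{E}(Q)$ whose coefficient at $x^{m/(a\delta)}y^{n/(a\delta)}$ is $1$. Let $\mathbb{T}_F=\{\alpha\in\mathbb{T}:\mathrm{supp}(F-\alpha(E^\circ))\subseteq N^0(F)\setminus\mathcal{N}''\}$ (nonempty) and $\mathbb{V}_F=\{N^0(F-\alpha(E^\circ)):\alpha\in\mathbb{T}_F\}$, a finite set partially ordered by inclusion. For each such $F$ a minimal element $V^\circ\in\mathbb{V}_F$ and $\alpha^\circ\in\mathbb{T}_F$ with $V^\circ=N^0(F-\alpha^\circ(E^\circ))$ are fixed, and $F^\circ=F-\alpha^\circ(E^\circ)$ (the remainder). Divisibility: $f\mid g$ means $g/f$ is a (Laurent) polynomial; in particular any polynomial is divisible by $(x+1)^l$ and by $(x+y)^l$ when $l\le0$. Let $\varepsilon=\frac{1}{m(n-m)}$ and $i\in\mathbb{Z}_{\ge0}$. $F^\circ$ satisfies the $i$-th collection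 of $(0,1)$-DC if $(F^\circ)^{(0,1)}_j$ is divisible by $(x+1)^{j-\lfloor i(n-m)\varepsilon\rfloor}$ for each $j\in\mathbb{Z}$. $F^\circ$ satisfies the $i$-th collection of $(1,1)$-DC if $(F^\circ)^{(1,1)}_j$ is divisible by $(x+y)^{j-\lfloor(i+1)m\varepsilon\rfloor}$ for each $j\in\mathbb{Z}$. $F^\circ$ satisfies the $i$-th collection of DC if it satisfies both. $F^\circ$ satisfies the $i$-th collection of DSC if it satisfies the $i$-th collection of DC and $\mathrm{supp}(F^\circ)\subseteq T_{a_i,b_i}$, where $a_i=\lfloor(i+1)m\varepsilon\rfloor$ and $b_i=\lfloor(i+1)m\varepsilon\rfloor+\lfloor i(n-m)\varepsilon\rfloor$. *)

(* Defs.v *)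
From HB Require Import structures.
From mathcomp Require Import all_boot all_order all_algebra.
From mathcomp Require Import all_classical reals convex complex.
Set Implicit Arguments.
Unset Strict Implicit.
Unset Printing Implicit Defensive.
Import Order.TTheory GRing.Theory Num.Theory.
Local Open Scope classical_set_scope.
Local Open Scope ring_scope.

(* C[x,y], with the conventions of polyXY: x is the outer variable 'X and y
   is the inner variable 'Y = 'X%:P, so that f`_i`_j is the coefficient of
   x^i y^j in f. The field C is R[i] for a realType R. *)
Notation cpoly2 R := {poly {poly R[i]}}.

Notation plane R := (R^o * R^o)%type.

Section Polynomials.
Variable R : realType.
Implicit Types (f g h p E : cpoly2 R) (alpha : {poly R[i]}).

Definition dX f : cpoly2 R := f^`().
Definition dY f : cpoly2 R := map_poly (@deriv _) f.
Definition bracket f g : cpoly2 R := dX f * dY g - dX g * dY f.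

Definition is_constant f : Prop := exists c : R[i], f = c%:P%:P.

Definition mono (i j : nat) : cpoly2 R := 'X ^+ i * 'Y ^+ j.

(* The sum of the terms c x^i y^j of f with w.1 i + w.2 j = d. *)
Definition wpart (w : nat * nat) f (d : int) : cpoly2 R :=
  \poly_(i < size f) \poly_(j < size f`_i)
     (if (w.1 * i + w.2 * j)%N%:Z == d then f`_i`_j else 0).

(* Divisibility of f by p ^ l, l an integer: for l < 0 the quotient
   f * p ^ |l| is always a polynomial. *)
Definition pow_dvd p (l : int) f : Prop :=
  match l with
  | Posz k => exists h, f = p ^+ k * h
  | Negz _ => True
  end.

Definition psubst alpha E : cpoly2 R := alpha^:P \Po E.

Definition bbT : set {poly R[i]} :=
  [set alpha : {poly R[i]} | [/\ (2 <= size alpha)%N, alpha \is monic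
                 & alpha`_(size alpha).-2 = 0]].

Definition calE f : set (cpoly2 R) :=
  [set E | exists2 alpha, bbT alpha & f = psubst alpha E].

Definition principal f : Prop := calE f = [set f].

End Polynomials.

Section Polygons.
Variable R : realType.
Implicit Types (f : cpoly2 R) (A : set (plane R)).

Definition pt (i j : nat) : plane R := (i%:R, j%:R).

Definition supp f : set (plane R) :=
  [set q | exists i j : nat, f`_i`_j != 0 /\ q = pt i j].

Definition hull A : set (plane R) := smallest (@convex_set R (plane R)) A.

Definition N0 f : set (plane R) :=
  if f == 0 then set0 else hull (supp f `|` [set pt 0 0]).

Definition Tmn (m n : int) : set (plane R) :=
  [set q : plane R | 0 <= q.2 <= n%:~R /\ 0 <= q.1 <= m%:~R + n%:~R - q.2].

Definition dilate (r : R) A : set (plane R) := [set r *: q | q in A].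
Definition translate (v : plane R) A : set (plane R) := [set q + v | q in A].

End Polygons.

Definition calQ (a b m n : nat) : Prop :=
  [/\ [/\ (0 < a)%N, (0 < b)%N, (0 < m)%N & (0 < n)%N],
      (m < n)%N, (a %| m)%N && (a %| n)%N, coprime a b & (2 <= a < b)%N].

Section Conditions.
Variable R : realType.
Implicit Types (F G : cpoly2 R).

Definition cond1 (m n : nat) F : Prop :=
  N0 F = @Tmn R m n /\ N0 (F - mono R m n) `<` N0 F.

Definition cond2 (m n : nat) F : Prop :=
  forall i : nat, (i <= m)%N ->
    pow_dvd ('X + 1) (m%:Z - i%:Z) (wpart (0, 1)%N F (n%:Z - i%:Z)).

Definition cond3 (m n : nat) F : Prop :=
  forall i : nat, (i <= n)%N ->
    pow_dvd ('X + 'Y) (n%:Z - i%:Z) (wpart (1, 1)%N F (m%:Z + n%:Z - i%:Z)).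

Definition cond4 (a b m n : nat) G : Prop :=
  N0 G = @Tmn R (b * m %/ a)%N (b * n %/ a)%N /\
  N0 (G - mono R (b * m %/ a) (b * n %/ a)) `<` N0 G.

Definition cond5 F G : Prop := is_constant (bracket F G).

Definition cond1to3 (m n : nat) F : Prop :=
  [/\ cond1 m n F, cond2 m n F & cond3 m n F].

Definition cond1to5 (a b m n : nat) F G : Prop :=
  [/\ cond1to3 m n F, cond4 a b m n G & cond5 F G].

End Conditions.

Section Generator.
Variable R : realType.
Implicit Types (F Q E : cpoly2 R).

Definition polyN' (a m n : nat) : set (plane R) := dilate a%:R^-1 (@Tmn R m n).

Definition polyN'' (a m n : nat) : set (plane R) :=
  translate (((a - 1)%N%:R / a%:R) *: pt R m n) (polyN' a m n).

Definition is_approx_root (a m n : nat) F Q : Prop :=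
  [/\ N0 (Q - mono R (m %/ a) (n %/ a)) `<` N0 Q,
      N0 Q = polyN' a m n
    & supp (F - Q ^+ a) `<=` N0 F `\` polyN'' a m n].

Definition is_delta (a m n : nat) Q (delta : nat) : Prop :=
  (0 < delta)%N /\
  forall E, calE Q E -> principal E ->
    N0 E = dilate (delta * a)%N%:R^-1 (@Tmn R m n).

Definition is_generator (a m n : nat) F E : Prop :=
  exists Q (delta : nat),
    [/\ is_approx_root a m n F Q, is_delta a m n Q delta,
        principal E, calE Q E
      & E`_(m %/ (a * delta))`_(n %/ (a * delta)) = 1].

(* The F-generator, by definite description: under calQ a b m n and
   cond1to3 m n F there is exactly one E with is_generator a m n F E. The
   default 0 is only taken when there is none. *)
Definition Fgen (a m n : nat) F : cpoly2 R := xget 0 (is_generator a m n F).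

Definition TF (a m n : nat) F : set {poly R[i]} :=
  bbT (R := R) `&`
  [set alpha | supp (F - psubst alpha (Fgen a m n F))
               `<=` N0 F `\` polyN'' a m n].

Definition VF (a m n : nat) F : set (set (plane R)) :=
  [set N0 (F - psubst alpha (Fgen a m n F)) | alpha in TF a m n F].

Definition minimal_in (VV : set (set (plane R))) (V : set (plane R)) : Prop :=
  VV V /\ forall W, VV W -> W `<=` V -> W = V.

End Generator.

Section Remainder.
Variable R : realType.

(* A simultaneous choice of the polynomials alpha^o, for all (a, b, m, n) and
   F; the minimal element V^o and the remainder F^o are determined by it. *)
Variable ao : nat -> nat -> nat -> nat -> cpoly2 R -> {poly R[i]}.

Definition Frem (a b m n : nat) (F : cpoly2 R) : cpoly2 R :=
  F - psubst (ao a b m n F) (Fgen a m n F).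

Definition Vmin (a b m n : nat) (F : cpoly2 R) : set (plane R) :=
  N0 (Frem a b m n F).

Definition minimal_choice : Prop :=
  forall (a b m n : nat) (F : cpoly2 R), calQ a b m n -> cond1to3 m n F ->
    TF a m n F (ao a b m n F) /\ minimal_in (VF a m n F) (Vmin a b m n F).

End Remainder.

Section Divisibility.
Variable R : realType.
Implicit Types (f : cpoly2 R) (m n i : nat).

Definition eps m n : rat := (m * (n - m))%N%:R^-1.

Definition floor01 m n i : int := Num.floor ((i * (n - m))%N%:R * eps m n).
Definition floor11 m n i : int := Num.floor ((i.+1 * m)%N%:R * eps m n).

Definition DC01 m n f i : Prop :=
  forall j : int, pow_dvd ('X + 1) (j - floor01 m n i) (wpart (0, 1)%N f j).

Definition DC11 m n f i : Prop :=
  forall j : int, pow_dvd ('X + 'Y) (j - floor11 m n i) (wpart (1, 1)%N f j).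

Definition DC m n f i : Prop := DC01 m n f i /\ DC11 m n f i.

Definition DSC m n f i : Prop :=
  DC m n f i /\
  supp f `<=` @Tmn R (floor11 m n i) (floor11 m n i + floor01 m n i).

End Divisibility.

Section Assertions.
Variable R : realType.
Variable ao : nat -> nat -> nat -> nat -> cpoly2 R -> {poly R[i]}.

(* The integer m (n - m) (a - 1) / a; the division is exact when a %| m. *)
Definition bound (a m n : nat) : nat := (m * (n - m) * (a - 1) %/ a)%N.

Definition assertionD : Prop :=
  forall (a b m n : nat) (F G : cpoly2 R),
    calQ a b m n -> cond1to5 a b m n F G ->
    let Fo := Frem ao a b m n F in
    [/\ forall i : nat, (bound a m n + 1 <= i <= m * (n - m))%N ->
          DC01 m n Fo i -> DC01 m n Fo (i - 1)%N,
        forall i : nat, (bound a m n <= i <= m * (n - m))%N ->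
          DC11 m n Fo i -> DC11 m n Fo (i - 1)%N
      & forall i : nat, (1 <= i <= bound a m n)%N ->
          DSC m n Fo i -> DC m n Fo (i - 1)%N].

(* The four statements are equivalent, so "any of them is true" is their
   conjunction. *)
Definition assertionC : Prop :=
  forall (a b m n : nat) (F G : cpoly2 R),
    calQ a b m n -> cond1to5 a b m n F G ->
    [/\ VF a m n F set0,
        exists2 alpha, bbT alpha & F - psubst alpha (Fgen a m n F) = 0,
        Vmin ao a b m n F = set0
      & Frem ao a b m n F = 0].

End Assertions.

(* Main.v *)
Require Import Defs.
From HB Require Import structures.
From mathcomp Require Import all_boot all_order all_algebra.
From mathcomp Require Import all_classical reals convex complex.
From mathcomp Require Import zify ring.

(** The remainder F - alpha(E) is driven to zero by running the divisibility
conditions from i = m (n - m) down to i = 0.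

Both gradings are put in the same form. For w = (0,1) one reads f as a
polynomial in t = y with coefficients in C[X], X = x; for w = (1,1) one reads
the sheared polynomial f(t, X t), whose coefficient at t^d is the
dehomogenization of the part of f of total degree d, so that x + y becomes
(X + 1) t. In both cases a collection of divisibility conditions says that, for
some c, the coefficient at t^j is divisible by (X + 1)^(j - c) for all j
([row_dvd]). With the truncated subtraction of natural numbers this is a
filtration: the constants c add up under multiplication.

To start the descent the remainder must satisfy the conditions with
i = m (n - m). F does, by [cond2] and [cond3], so it suffices that the generator E
inherits them, with the constant divided by k = deg alpha. This is
[row_dvd_root], an induction down the rows of E: at depth s the power E^k
involves the new row e_s only through k e_0^(k-1) e_s, and a remainder row that
is both divisible by (X + 1)^((k-1) M') and of smaller degree vanishes.

The order of the steps matters. The support condition on F - alpha(E) bounds the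
rows of the (0,1) grading, but not those of the (1,1) grading, where the
excluded region leaves points with x < (a-1) m / a and large y. Therefore
the first part of [assertionD] comes first: it brings the (0,1)-conditions down to
i = m (n - m) (a-1) / a, which together with the support condition forces the
y-degree of the remainder below (a-1) n / a ([low_remainder]). Only then does
[row_dvd_root] apply to the (1,1) grading, and the second part brings these
conditions down as well.

From there on the third part applies at every step, because DC already implies DSC
for any polynomial f ([row_dvd_support]). Write c_i = b_i - a_i, so that a_i and
c_i are the constants of the (1,1)- and (0,1)-conditions. If B is the y-degree
and D the total degree of f, the two top rows give D - a_i <= B and
B - c_i <= D - B, whence B <= a_i + c_i = b_i and D <= a_i + b_i. At i = 0 this
says that the remainder is a constant. Adding that constant to alpha keeps alpha
in T_F and makes the remainder zero, so that by minimality it was zero. *)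

Set Implicit Arguments.
Unset Strict Implicit.
Unset Printing Implicit Defensive.
Import Order.TTheory GRing.Theory Num.Theory.
Local Open Scope ring_scope.

(** * Row divisibility *)

Section RowDivisibility.
Variables (K : fieldType) (p : {poly K}).
Implicit Types (f g E : {poly {poly K}}) (al : {poly K}).

(** Rows are the coefficients with respect to the outer variable. For j <= c the
truncated exponent is 0, which matches the convention that any polynomial is
divisible by a power with exponent l <= 0. *)
Definition row_dvd (c : nat) f : Prop := forall j, p ^+ (j - c) %| f`_j.

Lemma row_dvd_weaken c d f : (c <= d)%N -> row_dvd c f -> row_dvd d f.
Proof.
move=> lecd hf j; apply: dvdp_trans (hf j); apply: dvdp_exp2l; lia.
Qed.

(** The form taken by [cond2] and [cond3], which count the rows from the top. *)
Lemma row_dvd_from_top M N f : (M <= N)%N -> (size f <= N.+1)%N ->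
    (forall s, (s <= M)%N -> p ^+ (M - s) %| f`_(N - s)) ->
  row_dvd (N - M) f.
Proof.
move=> leMN sf rows j; case: (leqP j N) => [lejN|ltNj]; last first.
  by rewrite nth_default ?dvdp0 // (leq_trans sf).
case: (leqP (N - M) j) => [le|lt]; last first.
  by rewrite (_ : (j - (N - M) = 0)%N) ?expr0 ?dvd1p //; lia.
have := rows (N - j)%N; rewrite subKn // (_ : (M - (N - j) = j - (N - M))%N).
  by apply; lia.
lia.
Qed.

Lemma row_dvdB c f g : row_dvd c f -> row_dvd c g -> row_dvd c (f - g).
Proof. by move=> hf hg j; rewrite coefB dvdp_sub. Qed.

Lemma row_dvd_sum c n (F : nat -> {poly {poly K}}) :
  (forall i, (i < n)%N -> row_dvd c (F i)) -> row_dvd c (\sum_(i < n) F i).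
Proof.
move=> hF j; rewrite coef_sum.
by apply: (big_ind (fun q => p ^+ (j - c) %| q)) => [|x y|i _];
  [exact: dvdp0 | exact: dvdp_add | exact: hF].
Qed.

(** In truncated arithmetic (j - (c + d)) <= (i - c) + (j - i - d), so the constants
add up as in a filtration. *)
Lemma row_dvdM c d f g :
  row_dvd c f -> row_dvd d g -> row_dvd (c + d) (f * g).
Proof.
move=> hf hg j; rewrite coefM.
apply: (big_ind (fun q => p ^+ (j - (c + d)) %| q)) => [|x y|i _];
  [exact: dvdp0 | exact: dvdp_add |].
apply: dvdp_trans (dvdp_mul (hf i) (hg (j - i)%N)).
rewrite -exprD; apply: dvdp_exp2l; have := ltn_ord i; lia.
Qed.

Lemma row_dvdC c (q : {poly K}) : row_dvd c q%:P.
Proof.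
move=> j; rewrite coefC; case: eqP => [->|_]; last by rewrite dvdp0.
by rewrite sub0n expr0 dvd1p.
Qed.

Lemma row_dvdX c f k : row_dvd c f -> row_dvd (k * c) (f ^+ k).
Proof.
move=> hf; elim: k => [|k IHk]; first by rewrite expr0; apply: row_dvdC.
by rewrite exprS mulSn; apply: row_dvdM.
Qed.

Lemma comp_constE al E :
  al^:P \Po E = \sum_(i < size al) (al`_i)%:P%:P * E ^+ i.
Proof.
rewrite comp_polyE size_map_polyC; apply: eq_bigr => i _.
by rewrite coef_map -mul_polyC.
Qed.

Lemma row_dvd_comp c al E :
  row_dvd c E -> row_dvd ((size al).-1 * c) (al^:P \Po E).
Proof.
move=> hE; rewrite comp_constE.
apply: (row_dvd_sum (F := fun i => (al`_i)%:P%:P * E ^+ i)) => i ltin.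
have le_c : (0 + i * c <= (size al).-1 * c)%N by nia.
apply: (row_dvd_weaken le_c).
by apply: row_dvdM; [exact: row_dvdC | exact: row_dvdX].
Qed.

End RowDivisibility.

Section TopCoefficients.
Variable A : idomainType.
Implicit Types f g : {poly A}.

Lemma size_le_mul f g a b : (size f <= a.+1)%N -> (size g <= b.+1)%N ->
  (size (f * g)%R <= (a + b).+1)%N.
Proof. move=> hf hg; have := size_polyMleq f g; lia. Qed.

Lemma size_le_exp f a k :
  (size f <= a.+1)%N -> (size (f ^+ k)%R <= (k * a).+1)%N.
Proof. move=> hf; have := size_poly_exp_leq f k; nia. Qed.

Lemma coefM_top f g a b : (size f <= a.+1)%N -> (size g <= b.+1)%N ->
  (f * g)`_(a + b) = f`_a * g`_b.
Proof.
move=> hf hg; have lta : (a < (a + b).+1)%N by lia.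
rewrite coefM (bigD1 (Ordinal lta)) //= addKn big1 ?addr0 // => i /eqP ne_i.
have ne_ia : nat_of_ord i <> a by move=> e; apply: ne_i; apply: val_inj.
case: (ltnP a i) => [lti|gti].
  by rewrite [f`_i]nth_default ?mul0r //; apply: leq_trans hf lti.
by rewrite [g`__]nth_default ?mulr0 //; apply: leq_trans hg _; lia.
Qed.

Lemma coefX_top f a k : (size f <= a.+1)%N -> (f ^+ k)`_(k * a) = f`_a ^+ k.
Proof.
move=> hf; elim: k => [|k IHk]; first by rewrite !expr0 coef1.
by rewrite !exprS mulSn coefM_top ?IHk // size_le_exp.
Qed.

End TopCoefficients.

Section GeometricSum.
Variable A : idomainType.
Implicit Types f g : {poly A}.

(** The cofactor of f - g in f ^+ k - g ^+ k. Its use is that, when f and g share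
their top coefficient, its own top coefficient is that of the derivative of
f ^+ k, so powers are linearized without a multinomial expansion. *)
Definition geom_sum (k : nat) f g := \sum_(i < k) f ^+ (k.-1 - i) * g ^+ i.

Lemma geom_sumE k f g : f ^+ k - g ^+ k = (f - g) * geom_sum k f g.
Proof. exact: subrXX. Qed.

Lemma geom_sum_top k f g a : (0 < k)%N ->
    (size f <= a.+1)%N -> (size g <= a.+1)%N -> f`_a = g`_a ->
  (size (geom_sum k f g) <= (k.-1 * a).+1)%N /\
  (geom_sum k f g)`_(k.-1 * a) = f`_a ^+ k.-1 *+ k.
Proof.
case: k => // k _ hf hg efg; rewrite /geom_sum /=; split.
  apply: (leq_trans (size_sum _ _ _)); apply/bigmax_leqP => i _.
  have -> : (k * a = (k - i) * a + i * a)%N by have := ltn_ord i; nia.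
  by apply: size_le_mul; apply: size_le_exp.
rewrite coef_sum (eq_bigr (fun=> f`_a ^+ k)).
  by rewrite sumr_const card_ord.
move=> i _; have lei : (i <= k)%N by have := ltn_ord i.
have -> : (k * a = (k - i) * a + i * a)%N by nia.
rewrite coefM_top ?size_le_exp // !coefX_top //.
by rewrite -efg -exprD subnK.
Qed.

End GeometricSum.

(** * Inheritance of row divisibility by approximate roots *)

Section Root.
Variables (K : numFieldType) (p : {poly K}).
Hypotheses (p_monic : p \is monic) (size_p : size p = 2%N).
Implicit Types (P E : {poly {poly K}}) (al : {poly K}).

Lemma size_linear_exp k : size (p ^+ k) = k.+1.
Proof.
have pk0 : p ^+ k != 0 by rewrite monic_neq0 ?monic_exp.
by rewrite polySpred // size_exp size_p mul1n.
Qed.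

Lemma dvd_small_eq0 k (q : {poly K}) : p ^+ k %| q -> (size q <= k)%N -> q = 0.
Proof.
move=> dvd_q le_q; apply/eqP; apply: contraTT dvd_q => q0.
by rewrite gtNdvdp // size_linear_exp.
Qed.

(** The lower powers of E only reach the rows up to k.-1 * N'. *)
Lemma comp_const_top al E k N' j : al \is monic -> size al = k.+1 ->
  (size E <= N'.+1)%N -> (k.-1 * N' < j)%N ->
  (al^:P \Po E)`_j = (E ^+ k)`_j.
Proof.
move=> al_monic size_al sE ltj; rewrite comp_constE size_al big_ord_recr /=.
have alk : al`_k = 1 by move/monicP: al_monic; rewrite lead_coefE size_al.
rewrite alk mul1r coefD coef_sum big1 ?add0r // => i _.
rewrite mul_polyC coefZ [(E ^+ i)`_j]nth_default ?mulr0 //.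
apply: leq_trans (size_le_exp _ sE) _.
have := ltn_ord i; nia.
Qed.

(** Approximate k-th roots are unique: if e differed from p ^+ M', the difference
of the k-th powers would be a nonzero multiple of [geom_sum], whose degree is
exactly k.-1 * M' because its leading coefficient k is nonzero. *)
Lemma monic_root_unique k M' (e : {poly K}) : (0 < k)%N ->
  e \is monic -> size e = M'.+1 ->
  (size (p ^+ (k * M') - e ^+ k)%R <= k.-1 * M')%N -> e = p ^+ M'.
Proof.
move=> k_gt0 e_monic size_e small.
have pM_monic : p ^+ M' \is monic by rewrite monic_exp.
have topE (q : {poly K}) : q \is monic -> size q = M'.+1 -> q`_M' = 1.
  by move=> /monicP; rewrite lead_coefE => + sq; rewrite sq.
have [|||_ top] := @geom_sum_top _ k (p ^+ M') e M' k_gt0.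
- by rewrite size_linear_exp.
- by rewrite size_e.
- by rewrite !topE ?size_linear_exp.
rewrite topE ?size_linear_exp // expr1n in top.
have geom_large : (k.-1 * M' < size (geom_sum k (p ^+ M') e))%N.
  rewrite ltnNge; apply/negP => le; move: top; rewrite nth_default // => /eqP.
  by rewrite eq_sym pnatr_eq0 eqn0Ngt k_gt0.
apply/eqP; rewrite eq_sym -subr_eq0; apply/eqP.
apply: contraTeq small => ne0; rewrite -ltnNge [(k * M')%N]mulnC exprM geom_sumE.
have g0 : geom_sum k (p ^+ M') e != 0.
  by rewrite -size_poly_gt0; apply: leq_ltn_trans geom_large.
by rewrite size_mul // (polySpred ne0) addSn /=; apply: ltn_addl.
Qed.

Lemma size_sub_top n (f g : {poly K}) : (size f <= n.+1)%N ->
  (size g <= n.+1)%N -> f`_n = g`_n -> (size (f - g)%R <= n)%N.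
Proof.
move=> sf sg efg; apply/leq_sizeP => j; rewrite leq_eqVlt coefB.
case/predU1P => [<-|ltnj]; first by rewrite efg subrr.
by rewrite !nth_default ?subrr // (leq_trans _ ltnj).
Qed.

(** P satisfies the divisibility conditions and al(E) agrees with P up to small
errors in the rows at depth s <= M'; then E satisfies the conditions of P divided
by k. Induction on s: writing U for the rows of E above depth s, row s of E^k is
that of U^k plus k e_0^(k-1) e_s. All other terms of row s are divisible by
p^(k M' - s), hence by p^((k-1) M'), and so is the error; being of smaller degree
the error vanishes, and cancelling p^((k-1) M') leaves the condition on e_s. *)
Lemma row_dvd_root P E al k M' N' : (0 < k)%N -> (M' < N')%N ->
    al \is monic -> size al = k.+1 ->
    (size E <= N'.+1)%N -> E`_N' \is monic -> size E`_N' = M'.+1 ->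
    row_dvd p (k * N' - k * M') P ->
    (forall s, (s <= M')%N ->
       (size ((P - (al^:P \Po E))`_(k * N' - s))%R <= k.-1 * M')%N) ->
  row_dvd p (N' - M') E.
Proof.
move=> k_gt0 ltMN al_monic size_al sE e_monic size_e hP hR.
have comp_top s : (s <= M')%N ->
    (al^:P \Po E)`_(k * N' - s) = (E ^+ k)`_(k * N' - s).
  by move=> les; apply: (comp_const_top al_monic size_al sE); nia.
have top0 : E`_N' = p ^+ M'.
  apply: (monic_root_unique k_gt0 e_monic size_e).
  have := hR 0%N (leq0n _); rewrite coefB comp_top // subn0 coefX_top // => small.
  suff /eqP : P`_(k * N') - p ^+ (k * M') = 0 by rewrite subr_eq0 => /eqP <-.
  apply: (@dvd_small_eq0 (k * M')).
    apply: dvdp_sub; rewrite // -{1}[(k * M')%N](_ : k * N' - (k * N' - k * M') = _)%N //.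
    nia.
  have size_pk : (size (p ^+ (k * M'))%R <= (k * M').+1)%N by rewrite size_linear_exp.
  have size_ek : (size (E`_N' ^+ k)%R <= (k * M').+1)%N.
    by apply: size_le_exp; rewrite size_e.
  rewrite -[P`_(k * N')](subrK (E`_N' ^+ k)) -addrA.
  apply: (leq_trans (size_polyD _ _)); rewrite geq_max; apply/andP; split.
    by apply: leq_trans small _; nia.
  apply: size_sub_top => //.
  rewrite coefX_top ?size_e //.
  have -> : E`_N'`_M' = 1 by move/monicP: e_monic; rewrite lead_coefE size_e.
  have /monicP := monic_exp (k * M') p_monic; rewrite lead_coefE size_linear_exp /= => ->.
  by rewrite expr1n.
have rows s : (s <= M')%N -> p ^+ (M' - s) %| E`_(N' - s).
  elim/ltn_ind: s => -[_ _|s IHs lesM]; first by rewrite !subn0 top0.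
  (* U collects the rows of E above depth s + 1, V the others. *)
  pose V := take_poly (N' - s.+1).+1 E; pose U := E - V.
  have coefU j : U`_j = if (j < (N' - s.+1).+1)%N then 0 else E`_j.
    by rewrite coefB coef_take_poly; case: ifP; rewrite ?subrr ?subr0.
  have sV : (size V <= (N' - s.+1).+1)%N by exact: size_take_poly.
  have sU : (size U <= N'.+1)%N.
    apply/leq_sizeP => j ltj; rewrite coefU; case: ifP => // _.
    by rewrite nth_default // (leq_trans sE).
  have topU : E`_N' = U`_N' by rewrite coefU ifF //; lia.
  have rowU : row_dvd p (N' - M') U.
    move=> j; rewrite coefU; case: ifP => [|/negbT]; first by rewrite dvdp0.
    case: (leqP j N') => [lej ltj|ltj _]; last first.
      by rewrite nth_default ?dvdp0 // (leq_trans sE).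
    have := IHs (N' - j)%N; have -> : (N' - (N' - j) = j)%N by lia.
    have -> : (M' - (N' - j) = j - (N' - M'))%N by lia.
    apply; lia.
  have [sG topG] := geom_sum_top k_gt0 sE sU topU.
  have := geom_sumE k E U; have -> : E - U = V by rewrite /U subKr.
  move/(congr1 (fun q : {poly {poly K}} => q`_(k * N' - s.+1))) => /eqP.
  have -> : (k * N' - s.+1 = (N' - s.+1) + k.-1 * N')%N by nia.
  rewrite [X in _ == X]coefM_top // topG /V coef_take_poly ltnSn coefB.
  have -> : ((N' - s.+1) + k.-1 * N' = k * N' - s.+1)%N by nia.
  rewrite subr_eq => /eqP Ek.
  have dvdU : p ^+ (k * M' - s.+1) %| (U ^+ k)`_(k * N' - s.+1).
    have := row_dvdX k rowU (k * N' - s.+1)%N.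
    by have -> : (k * N' - s.+1 - k * (N' - M') = k * M' - s.+1)%N by nia.
  have dvdP : p ^+ (k * M' - s.+1) %| P`_(k * N' - s.+1).
    have := hP (k * N' - s.+1)%N.
    by have -> : (k * N' - s.+1 - (k * N' - k * M') = k * M' - s.+1)%N by nia.
  have dvd_le (q : {poly K}) :
      p ^+ (k * M' - s.+1) %| q -> p ^+ (k.-1 * M') %| q.
    by apply: dvdp_trans; apply: dvdp_exp2l; nia.
  (* The error row is a multiple of p^((k-1) M') of smaller degree. *)
  have R0 : (P - (al^:P \Po E))`_(k * N' - s.+1) = 0.
    apply: (@dvd_small_eq0 (k.-1 * M')); last exact: hR.
    rewrite coefB comp_top // Ek; apply: dvdp_sub; first exact: dvd_le.
    apply: dvdp_add; last exact: dvd_le.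
    rewrite -mulr_natr; apply: dvdp_mull; apply: dvdp_mulr.
    by rewrite top0 -exprM dvdp_exp2l // mulnC.
  have : p ^+ (k * M' - s.+1) %| E`_(N' - s.+1) * (E`_N' ^+ k.-1 *+ k).
    move/eqP: R0; rewrite coefB comp_top // subr_eq0 => /eqP R0.
    have -> : E`_(N' - s.+1) * (E`_N' ^+ k.-1 *+ k) =
              P`_(k * N' - s.+1) - (U ^+ k)`_(k * N' - s.+1).
      by rewrite R0 Ek addrK.
    exact: dvdp_sub.
  rewrite top0 -exprM mulrnAr -scaler_nat dvdpZr ?pnatr_eq0 -?lt0n //.
  have -> : (k * M' - s.+1 = M' * k.-1 + (M' - s.+1))%N by nia.
  by rewrite exprD [X in _ %| X]mulrC dvdp_mul2l // monic_neq0 ?monic_exp.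
by apply: row_dvd_from_top; rewrite // ltnW.
Qed.

End Root.

(** * The two gradings *)

Section Gradings.
Variable K : fieldType.
Implicit Types f g : {poly {poly K}}.

(** The substitution x := t, y := X t, with t the outer variable of the result. *)
Definition shear f : {poly {poly K}} := swapXY (swapXY f \Po ('Y * 'X)).

Lemma shear_is_zmod_morphism : zmod_morphism shear.
Proof. by move=> f g; rewrite /shear !rmorphB. Qed.

Lemma shear_is_monoid_morphism : monoid_morphism shear.
Proof. by split=> [|f g]; rewrite /shear ?rmorph1 // !rmorphM. Qed.

HB.instance Definition _ := GRing.isZmodMorphism.Build
  {poly {poly K}} {poly {poly K}} shear shear_is_zmod_morphism.
HB.instance Definition _ := GRing.isMonoidMorphism.Build
  {poly {poly K}} {poly {poly K}} shear shear_is_monoid_morphism.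

Lemma coef_shear f d e :
  (shear f)`_d`_e = if (d < e)%N then 0 else f`_(d - e)`_e.
Proof.
rewrite coef_swapXY coef_comp_poly.
under eq_bigr => i _ do rewrite exprMn -rmorphXn coefCM coefXn.
case: (ltnP e (size (swapXY f))) => lte; last first.
  have -> : (if (d < e)%N then 0 else f`_(d - e)`_e) = (0 : K).
    by case: ifP => // _; rewrite -coef_swapXY (nth_default _ lte) coef0.
  rewrite big1 ?coef0 // => i _.
  by rewrite gtn_eqF ?mulr0 ?mulr0 // (leq_trans _ lte).
rewrite (bigD1 (Ordinal lte)) //= eqxx mulr1 big1 ?addr0.
  by rewrite coefMXn coef_swapXY.
move=> i /eqP nie; rewrite (_ : (e == i) = false) ?mulr0 //.
by apply/eqP => eqi; apply: nie; apply: val_inj.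
Qed.

Lemma shear_inj : injective shear.
Proof.
move=> f g /(congr1 (fun h : {poly {poly K}} => fun i j => h`_(i + j)`_j)) efg.
apply/polyP => i; apply/polyP => j.
move: (congr1 (fun h => h i j) efg) => /=.
by rewrite !coef_shear ltnNge leq_addl addnK.
Qed.

Lemma shear_const (c : K) : shear c%:P%:P = c%:P%:P.
Proof. by rewrite /shear !(swapXY_polyC, map_polyC) /= comp_polyC swapXY_polyC map_polyC. Qed.

Lemma shear_comp (al : {poly K}) f : shear (al^:P \Po f) = al^:P \Po shear f.
Proof.
rewrite !comp_constE rmorph_sum /=; apply: eq_bigr => i _.
by rewrite rmorphM rmorphXn /= shear_const.
Qed.

Lemma swapXY_sub_comp f g (al : {poly K}) :
  swapXY (f - (al^:P \Po g)) = swapXY f - (al^:P \Po swapXY g).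
Proof. by rewrite swapXY_is_zmod_morphism swapXY_comp_poly. Qed.

Lemma shear_sub_comp f g (al : {poly K}) :
  shear (f - (al^:P \Po g)) = shear f - (al^:P \Po shear g).
Proof. by rewrite shear_is_zmod_morphism shear_comp. Qed.

Lemma shear_X : shear 'X = 'X.
Proof. by rewrite /shear swapXY_X comp_polyC swapXY_Y. Qed.

Lemma shear_Y : shear 'Y = 'Y * 'X.
Proof. by rewrite /shear swapXY_Y comp_polyX rmorphM /= swapXY_Y swapXY_X mulrC. Qed.

(** The preimage is the homogenization of q in degree k. *)
Lemma shear_homogenize (q : {poly K}) k : (size q <= k.+1)%N ->
  exists h, shear h = q%:P * 'X^k.
Proof.
move=> sq; exists (\poly_(i < k.+1) (q`_(k - i) *: 'X^(k - i))).
apply/polyP => d; apply/polyP => e.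
rewrite coef_shear coefMXn coef_poly coefC.
case: (ltngtP d k) => [ltdk|ltkd|->].
- case: ltnP => [_|led]; first by rewrite coef0.
  case: (ltnP (d - e) k.+1) => _; rewrite ?coef0 //.
  by rewrite coefZ coefXn (_ : (e == _) = false) ?mulr0 //; lia.
- rewrite (_ : (d - k == 0)%N = false) ?coef0; last by lia.
  case: ltnP => // led; case: (ltnP (d - e) k.+1) => // ltde; last by rewrite coef0.
  by rewrite coefZ coefXn (_ : (e == _) = false) ?mulr0 //; lia.
- rewrite subnn eqxx; case: ltnP => [lt|le].
    by rewrite nth_default // (leq_trans sq lt).
  by rewrite ltnS leq_subr coefZ coefXn subKn // eqxx mulr1.
Qed.
End Gradings.

Section WeightedParts.
Variable R : realType.
Implicit Types (f : cpoly2 R).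
Local Notation p := ('X + 1 : {poly R[i]}).

Lemma monic_X1 : p \is monic.
Proof. by rewrite -[1]opprK -polyC1 -polyCN monicXsubC. Qed.

Lemma size_X1 : size p = 2%N.
Proof. by rewrite -polyC1 size_XaddC. Qed.

Lemma coef_wpart w f d i j :
  (wpart w f d)`_i`_j =
  if (w.1 * i + w.2 * j)%N%:Z == d then f`_i`_j else 0.
Proof.
rewrite /wpart coef_poly; case: ltnP => hi; last first.
  by rewrite [f`_i]nth_default // !coef0 if_same.
rewrite coef_poly; case: ltnP => hj //.
by rewrite nth_default // if_same.
Qed.

Lemma pow_dvd_neg (q : cpoly2 R) l f : (l < 0)%R -> pow_dvd q l f.
Proof. by case: l. Qed.

Lemma pow_dvdB (q : cpoly2 R) (j c : nat) f :
  pow_dvd q (j%:Z - c%:Z) f <-> exists h, f = q ^+ (j - c) * h.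
Proof.
case: (leqP c j) => [lecj|ltjc]; first by rewrite subzn.
split=> _; last by apply: pow_dvd_neg; lia.
by exists f; rewrite (_ : (j - c = 0)%N) ?expr0 ?mul1r //; lia.
Qed.

Lemma swapXY_wpart f d :
  swapXY (wpart (0, 1)%N f d%:Z) = ((swapXY f)`_d)%:P * 'X^d.
Proof.
apply/polyP => j; apply/polyP => i.
rewrite coef_swapXY coef_wpart coefMXn coefC /= mul0n add0n mul1n eqz_nat.
case: (ltngtP j d) => [ltjd|ltdj|->]; rewrite ?coef0 //.
  by rewrite (_ : (j - d == 0)%N = false) ?coef0 //; apply/eqP; lia.
by rewrite subnn eqxx coef_swapXY.
Qed.

Lemma shear_wpart f d :
  shear (wpart (1, 1)%N f d%:Z) = ((shear f)`_d)%:P * 'X^d.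
Proof.
apply/polyP => j; apply/polyP => i.
rewrite !coef_shear coef_wpart coefMXn coefC /= !mul1n eqz_nat.
case: (leqP i j) => [leij|ltij]; last first.
  case: ltnP => [|le]; rewrite ?coef0 //; case: eqP => // e; rewrite ?coef0 //.
  by rewrite coef_shear ifT //; lia.
rewrite subnK //.
case: (ltngtP j d) leij => [ltjd|ltdj|->] leij; rewrite ?coef0 //.
  by rewrite (_ : (j - d == 0)%N = false) ?coef0 //; apply/eqP; lia.
by rewrite subnn eqxx coef_shear ltnNge leij.
Qed.

Lemma pow_dvd_wpart01 f (d l : nat) :
  (exists h, wpart (0, 1)%N f d%:Z = ('X + 1) ^+ l * h) <->
  p ^+ l %| (swapXY f)`_d.
Proof.
have pE : swapXY ('X + 1 : cpoly2 R) = p%:P.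
  by rewrite rmorphD rmorph1 /= swapXY_X polyCD.
split=> [[h]|/dvdpP [q eq]].
  move/(congr1 swapXY); rewrite swapXY_wpart rmorphM rmorphXn /= pE.
  move/(congr1 (fun g : cpoly2 R => g`_d)).
  rewrite coefMXn ltnn subnn coefC eqxx -rmorphXn coefCM => ->.
  exact: dvdp_mulr.
exists (swapXY (q%:P * 'X^d)); apply: (can_inj (@swapXYK _)).
rewrite swapXY_wpart rmorphM rmorphXn /= pE swapXYK eq.
by rewrite mulrC -rmorphXn polyCM mulrCA mulrA mulrC mulrA.
Qed.

(** Since shear maps x + y to (X + 1) t, a factor (x + y)^l uses up t^l. The
quotient of the rows has degree at most d - l, so it can be homogenized back to
a quotient of the homogeneous part. *)
Lemma pow_dvd_wpart11 f (d l : nat) : (l <= d)%N ->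
  (exists h, wpart (1, 1)%N f d%:Z = ('X + 'Y) ^+ l * h) <->
  p ^+ l %| (shear f)`_d.
Proof.
move=> leld.
have pE : shear ('X + 'Y : cpoly2 R) = p%:P * 'X.
  by rewrite rmorphD /= shear_X shear_Y polyCD mulrDl mul1r addrC.
split=> [[h]|/dvdpP [q eq]].
  move/(congr1 (@shear _)); rewrite shear_wpart rmorphM rmorphXn /= pE.
  move/(congr1 (fun g : cpoly2 R => g`_d)).
  rewrite coefMXn ltnn subnn coefC eqxx exprMn -rmorphXn -mulrA coefCM => ->.
  exact: dvdp_mulr.
have size_rows : (size ((shear f)`_d)%R <= d.+1)%N.
  by apply/leq_sizeP => e lte; rewrite coef_shear lte.
have size_quotient (u : {poly R[i]}) :
    (size (u * p ^+ l)%R <= d.+1)%N -> (size u <= (d - l).+1)%N.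
  case: (eqVneq u 0) => [->|u0]; first by rewrite size_poly0.
  have pl0 : p ^+ l != 0 by rewrite monic_neq0 // monic_exp // monic_X1.
  rewrite size_mul // (size_linear_exp monic_X1 size_X1) addnS /=.
  by rewrite -subSn // leq_subRL ?(leqW leld) // addnC.
have sq : (size q <= (d - l).+1)%N by apply: size_quotient; rewrite -eq.
have [h hE] := shear_homogenize sq.
exists h; apply: (@shear_inj _).
rewrite shear_wpart rmorphM rmorphXn /= pE hE eq exprMn -rmorphXn polyCM.
by rewrite -{1}(subnKC leld) exprD; ring.
Qed.

Lemma DC01E m n f i c : floor01 m n i = c%:Z ->
  DC01 m n f i <-> row_dvd p c (swapXY f).
Proof.
move=> fl; rewrite /DC01 fl; split=> [dc j|dc [j|j]]; last by apply: pow_dvd_neg; lia.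
- by apply/pow_dvd_wpart01/pow_dvdB.
- by apply/pow_dvdB/pow_dvd_wpart01.
Qed.

Lemma DC11E m n f i c : floor11 m n i = c%:Z ->
  DC11 m n f i <-> row_dvd p c (shear f).
Proof.
move=> fl; rewrite /DC11 fl; split=> [dc j|dc [j|j]]; last by apply: pow_dvd_neg; lia.
- by apply/(pow_dvd_wpart11 _ (leq_subr _ _))/pow_dvdB.
- by apply/pow_dvdB/(pow_dvd_wpart11 _ (leq_subr _ _)).
Qed.

End WeightedParts.

Section Degrees.
Variable K : fieldType.
Implicit Types f : {poly {poly K}}.

Lemma leq_deg_swapXY f i j :
  f`_i`_j != 0 -> (j <= (size (swapXY f)).-1)%N.
Proof.
rewrite -coef_swapXY leqNgt; apply: contraNN => lt.
by rewrite (nth_default _ (leq_trans (leqSpred _) lt)) coef0.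
Qed.

Lemma leq_deg_shear f i j :
  f`_i`_j != 0 -> (i + j <= (size (shear f)).-1)%N.
Proof.
move=> nz; have : (shear f)`_(i + j)`_j != 0.
  by rewrite coef_shear ltnNge leq_addl addnK.
rewrite leqNgt; apply: contraNN => lt.
by rewrite (nth_default _ (leq_trans (leqSpred _) lt)) coef0.
Qed.

Lemma size_swapXY_leq f d :
  (forall i j, f`_i`_j != 0 -> (j <= d)%N) -> (size (swapXY f) <= d.+1)%N.
Proof.
move=> bnd; apply/leq_sizeP => j ltj; apply/polyP => i.
rewrite coef_swapXY coef0; apply/eqP; apply: contraTT ltj => /bnd.
by rewrite -leqNgt.
Qed.

Lemma size_shear_leq f d :
  (forall i j, f`_i`_j != 0 -> (i + j <= d)%N) -> (size (shear f) <= d.+1)%N.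
Proof.
move=> bnd; apply/leq_sizeP => j ltj; apply/polyP => i.
rewrite coef_shear coef0; case: ltnP => // leij.
by apply/eqP; apply: contraTT ltj => /bnd; rewrite subnK // -leqNgt.
Qed.

Lemma monic_of_top (q : {poly K}) d :
  (size q <= d.+1)%N -> q`_d = 1 -> q \is monic /\ size q = d.+1.
Proof.
move=> sq qd; have sE : size q = d.+1.
  apply/eqP; rewrite eqn_leq sq ltnNge; apply/negP => le.
  by move/eqP: qd; rewrite nth_default // eq_sym oner_eq0.
by split=> //; rewrite monicE lead_coefE sE qd.
Qed.

End Degrees.

(** * Floors, supports and polygons *)

Lemma floor_ratio (x y : nat) :
  (0 < y)%N -> Num.floor (x%:R * y%:R^-1 : rat) = (x %/ y)%N%:Z.
Proof.
move=> y_gt0; apply: floor_def.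
have y0 : (0 < y%:R :> rat) by rewrite ltr0n.
have -> : (x %/ y)%N%:Z + 1 = (x %/ y).+1%:Z by rewrite intS addrC.
rewrite ler_pdivlMr // ltr_pdivrMr // -!pmulrn -!natrM ler_nat ltr_nat.
by rewrite leq_divM ltn_ceil.
Qed.

Lemma floor01E m n i : (0 < m < n)%N -> floor01 m n i = (i %/ m)%N%:Z.
Proof.
move=> /andP[m0 mn]; rewrite /floor01 /eps floor_ratio; last by nia.
by rewrite divnMr // subn_gt0.
Qed.

Lemma floor11E m n i : (0 < m < n)%N -> floor11 m n i = (i.+1 %/ (n - m))%N%:Z.
Proof.
move=> /andP[m0 mn]; rewrite /floor11 /eps floor_ratio; last by nia.
by rewrite [(i.+1 * m)%N]mulnC divnMl.
Qed.

Section Supports.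
Variable R : realType.
Implicit Types f g F : cpoly2 R.
Local Open Scope classical_set_scope.

Lemma Tmn_pt (m n i j : nat) :
  @Tmn R m n (pt R i j) <-> (j <= n)%N /\ (i + j <= m + n)%N.
Proof.
rewrite /Tmn /pt /= !ler0n -!pmulrn -natrD lerBrDr -natrD !ler_nat /=.
by split=> -[].
Qed.

Lemma supp_sub f (A : set (plane R)) :
  supp f `<=` A <-> forall i j, f`_i`_j != 0 -> A (pt R i j).
Proof.
split=> [sub i j nz|sub q [i [j [nz ->]]]]; last exact: sub.
by apply: sub; exists i, j.
Qed.

Lemma supp_N0 f : supp f `<=` N0 f.
Proof.
move=> q [i [j [nz ->]]]; rewrite /N0; case: eqP => [f0|_].
  by move: nz; rewrite f0 !coef0 eqxx.
by apply: sub_gen_smallest; left; exists i, j.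
Qed.

Lemma N0_eq0 f : N0 f = set0 -> f = 0.
Proof.
rewrite /N0; case: eqP => // _ N00.
suff : (set0 : set (plane R)) (pt R 0 0) by [].
by rewrite -N00; apply: sub_gen_smallest; right.
Qed.

Lemma N00 : N0 (0 : cpoly2 R) = set0.
Proof. by rewrite /N0 eqxx. Qed.

Lemma N0_sub f g : supp f `<=` supp g -> N0 f `<=` N0 g.
Proof.
move=> sub; rewrite /N0; case: eqP => [_|f0]; [exact: sub0set|case: eqP => [g0|_]].
  exfalso; apply: f0; apply/polyP => i; apply/polyP => j; rewrite !coef0.
  apply: contrapT => /eqP nz.
  have [i' [j' [+ _]]] : supp g (pt R i j) by apply: sub; exists i, j.
  by rewrite g0 !coef0 eqxx.
by move=> x hx M [cM gM]; apply: hx; split=> // q [/sub|] hq; apply: gM; [left|right].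
Qed.

(** If the coefficient at x^m y^n were not 1, subtracting that monomial would not
shrink the support, and the inclusion of polygons could not be proper. *)
Lemma monic_corner F m n : cond1 m n F ->
  (forall i j, F`_i`_j != 0 -> (j <= n)%N /\ (i + j <= m + n)%N) /\ F`_m`_n = 1.
Proof.
move=> [N0F [_ proper]]; split=> [i j nz|].
  by apply/Tmn_pt; rewrite -N0F; apply: supp_N0; exists i, j.
apply: contrapT => Fmn; apply: proper; apply: N0_sub => q [i [j [nz ->]]].
exists i, j; split=> //; rewrite !coefB.
have -> : (mono R m n)`_i`_j = ((i == m) && (j == n))%:R.
  rewrite /mono mulrC -rmorphXn coefCM coefXn mulr_natr coefMn coefXn.
  by case: (i == m); case: (j == n).
case: (i =P m) nz => [->|_]; case: (j =P n) => [->|_] nz;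
  rewrite /= ?mulr0n ?subr0 //.
by rewrite subr_eq0; apply/eqP.
Qed.

Lemma dilate_Tmn_pt (k m n i j : nat) : (0 < k)%N ->
  dilate k%:R^-1 (@Tmn R m n) (pt R i j) ->
  (k * j <= n)%N /\ (k * (i + j) <= m + n)%N.
Proof.
move=> k0 [q Tq eq]; have -> : (k * (i + j) = k * i + k * j)%N by lia.
apply/Tmn_pt; suff -> : pt R (k * i) (k * j) = q by [].
have kn0 : k%:R != 0 :> R by rewrite pnatr_eq0 -lt0n.
have -> : pt R (k * i) (k * j) = k%:R *: pt R i j by rewrite /pt !natrM.
by rewrite -eq scalerA divff // scale1r.
Qed.

Lemma polyN''_pt (a m n i j : nat) : (0 < a)%N ->
  (a.-1 * m <= a * i)%N -> (a.-1 * n <= a * j)%N ->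
  (j <= n)%N -> (i + j <= m + n)%N ->
  @polyN'' R a m n (pt R i j).
Proof.
move=> a0 lei lej jn ijmn.
have an0 : a%:R != 0 :> R by rewrite pnatr_eq0 -lt0n.
exists (a%:R^-1 *: pt R (a * i - a.-1 * m) (a * j - a.-1 * n)).
  by exists (pt R (a * i - a.-1 * m) (a * j - a.-1 * n)) => //; apply/Tmn_pt; nia.
rewrite /pt subn1 !natrB // !natrM.
have coord (u v : R) :
  a%:R^-1 * (a%:R * u - a.-1%:R * v) + (a.-1%:R / a%:R) * v = u by field.
by congr pair; apply: coord.
Qed.

(** The top row of the (1,1) grading has degree at most B and that of the (0,1)
grading at most D - B. Both are nonzero, so the exponents of X + 1 dividing them
are bounded by these degrees; the two inequalities bound B and D. *)
Lemma row_dvd_support f c d :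
    row_dvd ('X + 1) c (swapXY f) -> row_dvd ('X + 1) d (shear f) ->
  forall i j, f`_i`_j != 0 -> (j <= d + c)%N /\ (i + j <= d + (d + c))%N.
Proof.
move=> row01 row11 i j nz.
pose B := (size (swapXY f)).-1; pose D := (size (shear f)).-1.
have f0 : f != 0 by apply: contraNneq nz => ->; rewrite !coef0.
have s0 : swapXY f != 0 by rewrite swapXY_eq0.
have h0 : shear f != 0.
  by apply: contraNneq f0 => h0; apply/eqP; apply: shear_inj; rewrite h0 raddf0.
have DB : (D - d <= B)%N.
  have top0 : (shear f)`_D != 0 by rewrite -lead_coefE lead_coef_eq0.
  rewrite leqNgt; apply/negP => lt; move/eqP: top0; apply.
  apply: (dvd_small_eq0 (monic_X1 R) (size_X1 R) (row11 D)).
  apply/leq_sizeP => e le; rewrite coef_shear; case: ltnP => // leD.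
  by apply: contrapT => /eqP /leq_deg_swapXY; rewrite -/B; lia.
have BD : (B - c <= D - B)%N.
  have top0 : (swapXY f)`_B != 0 by rewrite -lead_coefE lead_coef_eq0.
  rewrite leqNgt; apply/negP => lt; move/eqP: top0; apply.
  apply: (dvd_small_eq0 (monic_X1 R) (size_X1 R) (row01 B)).
  apply/leq_sizeP => e le; rewrite coef_swapXY.
  by apply: contrapT => /eqP /leq_deg_shear; rewrite -/D; lia.
have := leq_deg_swapXY nz; have := leq_deg_shear nz; rewrite -/B -/D.
have BleD : (B <= D)%N.
  have : (swapXY f)`_B != 0 by rewrite -lead_coefE lead_coef_eq0.
  rewrite -lead_coef_eq0 lead_coefE coef_swapXY => /leq_deg_shear; rewrite -/D; lia.
lia.
Qed.
End Supports.

(** * The generator and the start of the descent *)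

(** Here k is the degree of alpha, d the total degree of the generator and 1/l the
scale of its polygon. *)
Lemma integral_corner (k l d m n : nat) : (0 < l)%N -> (0 < n)%N ->
    (k * (n %/ l) = n)%N -> (k * d = m + n)%N -> (m %/ l + n %/ l <= d)%N ->
  (l <= k)%N /\ d = (m %/ l + n %/ l)%N.
Proof.
move=> l_gt0 n_gt0; have := leq_divM n l; have := ltn_ceil m l_gt0.
move: (n %/ l)%N (m %/ l)%N => n' m' ltm len degy degxy le_d.
have n'_gt0 : (0 < n')%N by case: n' degy {len le_d} => //; lia.
have lelk : (l <= k)%N by rewrite -(leq_pmul2r n'_gt0) mulnC degy.
split=> //; have [t dE] : exists t, d = (n' + t)%N by exists (d - n')%N; lia.
have kt : (k * t = m)%N by move: degxy; rewrite dE mulnDr degy; lia.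
have : (l * t < l * m'.+1)%N.
  by rewrite [(l * m'.+1)%N]mulnC; apply: leq_ltn_trans ltm; rewrite -kt leq_mul2r lelk orbT.
by rewrite ltn_pmul2l //; lia.
Qed.

Lemma scaled_bound (a k x : nat) : (0 < a <= k)%N ->
  (a.-1 * (k * x) <= a * (k.-1 * x))%N.
Proof.
case: a k => // a [|k] //= leak; rewrite !mulnA leq_mul2r.
by rewrite mulnS mulSn leq_add2r -ltnS leak orbT.
Qed.

Section Generator.
Variable R : realType.
Implicit Types (F E : cpoly2 R) (al : {poly R[i]}).

Lemma row_dvd_cond2 m n F : (m < n)%N -> cond1 m n F -> cond2 m n F ->
  row_dvd ('X + 1) (n - m) (swapXY F).
Proof.
move=> ltmn /monic_corner [supF _] dvdF.
apply: row_dvd_from_top => [||i lei]; first exact: ltnW.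
  by apply: size_swapXY_leq => i j /supF [].
apply/pow_dvd_wpart01; have := dvdF _ lei.
by rewrite !subzn // (leq_trans lei) // ltnW.
Qed.

Lemma row_dvd_cond3 m n F : cond1 m n F -> cond3 m n F ->
  row_dvd ('X + 1) m (shear F).
Proof.
move=> /monic_corner [supF _] dvdF; rewrite -[m in row_dvd _ m _](addnK n).
apply: row_dvd_from_top => [||i lei]; first exact: leq_addl.
  by apply: size_shear_leq => i j /supF [].
apply/pow_dvd_wpart11; first by rewrite leq_sub2r // leq_addl.
by have := dvdF _ lei; rewrite -PoszD !subzn // (leq_trans lei) // leq_addl.
Qed.

Section Remainder.
Variables (a b m n : nat) (F : cpoly2 R) (al : {poly R[i]}).
Hypotheses (Qabmn : calQ a b m n) (condF : cond1to3 m n F).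
Hypothesis TFal : TF a m n F al.
Local Notation E := (Fgen a m n F).
Local Notation rem := (F - psubst al E).

Let a_gt1 : (1 < a)%N. Proof. by case: Qabmn => _ _ _ _ /andP[]. Qed.
Let m_gt0 : (0 < m)%N. Proof. by case: Qabmn => -[]. Qed.
Let ltmn : (m < n)%N. Proof. by case: Qabmn. Qed.
Let condF1 : cond1 m n F. Proof. by case: condF. Qed.
Let supF : forall i j, F`_i`_j != 0 -> (j <= n)%N /\ (i + j <= m + n)%N.
Proof. by have [] := monic_corner condF1. Qed.
Let Fmn : F`_m`_n = 1. Proof. by have [] := monic_corner condF1. Qed.

Lemma remainder_support i j : rem`_i`_j != 0 ->
  [/\ (j <= n)%N, (i + j <= m + n)%N
    & ~ ((a.-1 * m <= a * i)%N /\ (a.-1 * n <= a * j)%N)].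
Proof.
case: TFal => _ /supp_sub sup /sup [N0F notN''].
case: condF1 => TF _; move: N0F; rewrite TF => /Tmn_pt [lejn leij]; split=> //.
move=> [lei lej]; apply: notN''; apply: polyN''_pt => //; exact: ltnW.
Qed.

Let rem_mn : rem`_m`_n = 0.
Proof.
apply: contrapT => /eqP /remainder_support [_ _]; apply.
by split; apply: leq_mul => //; apply: leq_pred.
Qed.

(** Without a generator the default value 0 would make alpha(E) constant, and
x^m y^n would remain in F - alpha(E), against the support condition of T_F. *)
Lemma Fgen_is_generator : is_generator a m n F E.
Proof.
case: (pselect (exists E', is_generator a m n F E')) => [|noE]; first exact: xgetPex.
have E0 : E = 0 by apply: xgetPN => E' genE'; apply: noE; exists E'.
move: rem_mn; rewrite E0 /psubst comp_poly0r !coefB Fmn coefC.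
by rewrite eqn0Ngt m_gt0 coef0 subr0 => /eqP; rewrite oner_eq0.
Qed.

(** The polygon of E is contained in T_(m,n) scaled by 1/l with l = delta a. Its
corner (m/l, n/l) is integral and k is at least a because F and alpha(E) have the
same y-degree and the same total degree: the remainder is zero at (m, n). *)
Lemma generator_shape : exists k m' n',
  [/\ [/\ al \is monic, size al = k.+1 & (a <= k)%N],
      m = (k * m')%N, n = (k * n')%N,
      forall i j, E`_i`_j != 0 -> (j <= n')%N /\ (i + j <= m' + n')%N
    & E`_m'`_n' = 1].
Proof.
have [Q [delta [_ [delta_gt0 N0E] prE QE Etop]]] := Fgen_is_generator.
case: TFal => -[size_al al_monic _] _.
pose l := (delta * a)%N; pose k := (size al).-1.
have l_gt0 : (0 < l)%N by rewrite muln_gt0 delta_gt0 ltnW.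
move: Etop; rewrite [(a * delta)%N]mulnC -/l.
set m' := (m %/ l)%N; set n' := (n %/ l)%N => Etop.
have supE i j : E`_i`_j != 0 -> (l * j <= n)%N /\ (l * (i + j) <= m + n)%N.
  move=> nz; apply: (@dilate_Tmn_pt R) => //.
  by rewrite -(N0E _ QE prE); apply: supp_N0; exists i, j.
have E_nz : E`_m'`_n' != 0 by rewrite Etop oner_eq0.
have compE i j : (psubst al E)`_i`_j = F`_i`_j - rem`_i`_j.
  by rewrite -!coefB subKr.
have supG i j : (psubst al E)`_i`_j != 0 -> (j <= n)%N /\ (i + j <= m + n)%N.
  rewrite compE; case: (eqVneq F`_i`_j 0) => [->|/supF //].
  by rewrite sub0r oppr_eq0 => /remainder_support [].
have G_nz : (psubst al E)`_m`_n != 0.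
  by rewrite compE rem_mn subr0 Fmn oner_eq0.
have size_alC : (size (al^:P)).-1 = k by rewrite size_map_polyC.
have degy : (k * n' = n)%N.
  have degE : (size (swapXY E)).-1 = n'.
    apply/eqP; rewrite eqn_leq (leq_deg_swapXY E_nz) andbT.
    rewrite -subn1 leq_subLR add1n; apply: size_swapXY_leq => i j /supE [le _].
    by rewrite leq_divRL // mulnC.
  rewrite -degE -size_alC -size_comp_poly -swapXY_comp_poly -/(psubst al E).
  apply/eqP; rewrite eqn_leq (leq_deg_swapXY G_nz) andbT.
  by rewrite -subn1 leq_subLR add1n; apply: size_swapXY_leq => i j /supG [].
pose d := (size (shear E)).-1.
have degxy : (k * d = m + n)%N.
  rewrite /d -size_alC -size_comp_poly -shear_comp -/(psubst al E).
  apply/eqP; rewrite eqn_leq (leq_deg_shear G_nz) andbT.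
  by rewrite -subn1 leq_subLR add1n; apply: size_shear_leq => i j /supG [].
have ge_d : (m' + n' <= d)%N := leq_deg_shear E_nz.
have [lelk dE] := integral_corner l_gt0 (ltn_trans m_gt0 ltmn) degy degxy ge_d.
exists k, m', n'; split=> //.
- split=> //; first by rewrite /k prednK // ltnW.
  by apply: leq_trans lelk; rewrite leq_pmull.
- by apply/eqP; rewrite -(eqn_add2r n) -[X in _ == (_ + X)%N]degy -mulnDr -dE degxy.
- move=> i j nz; split; last by rewrite -dE; exact: leq_deg_shear.
  by have [le _] := supE _ _ nz; rewrite leq_divRL // mulnC.
Qed.

(** At depth s <= m/k the y-degree is at least (a-1) n / a, where the support
condition bounds the x-degree of the remainder by (a-1) m / a. *)
Lemma remainder_row01 : row_dvd ('X + 1) (n - m) (swapXY rem).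
Proof.
have [k [m' [n' [[al_monic size_al le_ak] mE nE supE Etop]]]] := generator_shape.
have k_gt0 : (0 < k)%N by apply: leq_trans le_ak; apply: ltnW.
have rowF : row_dvd ('X + 1) (k * n' - k * m') (swapXY F).
  by rewrite -nE -mE; apply: row_dvd_cond2 => //; case: condF.
have m'n' : (m' < n')%N by rewrite -(ltn_pmul2l k_gt0) -mE -nE.
have [e_monic size_e] : (swapXY E)`_n' \is monic /\ size (swapXY E)`_n' = m'.+1.
  apply: monic_of_top; last by rewrite coef_swapXY.
  apply/leq_sizeP => i lti; rewrite coef_swapXY.
  by apply: contrapT => /eqP /supE []; lia.
rewrite swapXY_sub_comp.
have -> : (n - m = k * (n' - m'))%N by rewrite mulnBr -nE -mE.
apply: row_dvdB; first by rewrite mulnBr.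
have -> : k = (size al).-1 by rewrite size_al.
apply: row_dvd_comp.
apply: (row_dvd_root (monic_X1 R) (size_X1 R) k_gt0 m'n' al_monic size_al) => //.
  by apply: size_swapXY_leq => i j /supE [].
move=> s les; rewrite -swapXY_sub_comp.
apply/leq_sizeP => i lei; rewrite coef_swapXY.
apply: contrapT => /eqP /remainder_support [_ _]; apply.
split.
  apply: leq_trans (leq_mul (leqnn a) lei).
  by rewrite mE; apply: scaled_bound; rewrite le_ak ltnW.
rewrite nE mulnBr -[a.-1]subn1 mulnBl mul1n leq_sub2l //.
by apply: leq_mul => //; apply: leq_trans les (ltnW _).
Qed.

(** The hypothesis is what the support condition alone does not give: it bounds the
degree of every row of the (1,1) grading. *)
Lemma remainder_row11 :
    (forall i j, rem`_i`_j != 0 -> (a * j < a.-1 * n)%N) ->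
  row_dvd ('X + 1) m (shear rem).
Proof.
move=> low.
have [k [m' [n' [[al_monic size_al le_ak] mE nE supE Etop]]]] := generator_shape.
have k_gt0 : (0 < k)%N by apply: leq_trans le_ak; apply: ltnW.
have rowF : row_dvd ('X + 1) (k * (m' + n') - k * n') (shear F).
  rewrite -mulnBr addnK -mE.
  by apply: (row_dvd_cond3 condF1); case: condF.
have m'_gt0 : (0 < m')%N by move: m_gt0; rewrite mE muln_gt0 => /andP[].
have n'_lt : (n' < m' + n')%N by rewrite -add1n leq_add2r.
have [e_monic size_e] :
    (shear E)`_(m' + n') \is monic /\ size (shear E)`_(m' + n') = n'.+1.
  apply: monic_of_top; last by rewrite coef_shear ltnNge leq_addl addnK.
  apply/leq_sizeP => j ltj; rewrite coef_shear; case: ltnP => // _.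
  by apply: contrapT => /eqP /supE []; lia.
rewrite shear_sub_comp.
rewrite [X in row_dvd _ X _](_ : m = k * (m' + n' - n'))%N; last by rewrite addnK.
apply: row_dvdB; first by rewrite mulnBr.
have -> : k = (size al).-1 by rewrite size_al.
apply: row_dvd_comp.
apply: (row_dvd_root (monic_X1 R) (size_X1 R) k_gt0 n'_lt al_monic size_al) => //.
  by apply: size_shear_leq => i j /supE [].
move=> s les; rewrite -shear_sub_comp.
apply/leq_sizeP => j lej; rewrite coef_shear; case: ltnP => // _.
apply: contrapT => /eqP /low; rewrite nE => lt.
have := leq_ltn_trans (leq_mul (leqnn a) lej) lt.
by rewrite ltnNge scaled_bound // le_ak ltnW.
Qed.

End Remainder.
End Generator.

(** * The descent *)

Lemma descend (P : nat -> Prop) (lo hi : nat) : (lo <= hi)%N -> P hi ->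
  (forall i, (lo < i <= hi)%N -> P i -> P (i - 1)%N) -> P lo.
Proof.
move=> le Phi step; rewrite -(subKn le).
have : (hi - lo <= hi - lo)%N by [].
elim: {1 3}(hi - lo)%N => [_|k IHk lek]; first by rewrite subn0.
rewrite subnS -subn1; apply: step; last by apply: IHk; lia.
lia.
Qed.

Lemma boundE a m n : (0 < a)%N -> (a %| m)%N ->
  bound a m n = (m %/ a * (n - m) * a.-1)%N.
Proof.
move=> a_gt0 /dvdnP[m1 ->]; rewrite /bound mulnK // -subn1.
rewrite (_ : m1 * a * (n - m1 * a) * (a - 1) = m1 * (n - m1 * a) * (a - 1) * a)%N.
  by rewrite mulnK.
by rewrite -!mulnA; congr (_ * _)%N; rewrite mulnCA; congr (_ * _)%N; exact: mulnC.
Qed.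

Section Descent.
Variable R : realType.
Implicit Types (f F G E : cpoly2 R).

Lemma DC_DSC m n f i : (0 < m < n)%N -> DC m n f i -> DSC m n f i.
Proof.
move=> mn dc; split=> //; case: dc; rewrite floor01E // floor11E //.
move=> /(DC01E _ (floor01E _ mn)) row01 /(DC11E _ (floor11E _ mn)) row11.
apply/supp_sub => i' j' nz; rewrite -PoszD; apply/Tmn_pt.
exact: row_dvd_support row01 row11 _ _ nz.
Qed.

Lemma DC0_constant m n f : (0 < m)%N -> (m.+1 < n)%N -> DC m n f 0 ->
  f = (f`_0`_0)%:P%:P.
Proof.
move=> m_gt0 ltmn [].
have mn : (0 < m < n)%N by rewrite m_gt0 ltnW.
move=> /(DC01E _ (floor01E _ mn)) + /(DC11E _ (floor11E _ mn)).
rewrite div0n divn_small; last by lia.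
move=> row01 row11; apply/polyP => i; apply/polyP => j.
rewrite coefC; case: (eqVneq i 0%N) => [->|/eqP i0].
  rewrite coefC; case: (eqVneq j 0%N) => [->//|/eqP j0].
  by apply: contrapT => /eqP /(row_dvd_support row01 row11) []; lia.
by rewrite coef0; apply: contrapT => /eqP /(row_dvd_support row01 row11) []; lia.
Qed.

(** In degree at least 2 the constant term is not the coefficient that has to
vanish. *)
Lemma bbT_addC (al : {poly R[i]}) c : (2 < size al)%N ->
  bbT al -> bbT (al + c%:P).
Proof.
move=> size_al [_ al_monic al0].
have ltc : (size (c%:P) < size al)%N.
  by apply: leq_ltn_trans (size_polyC_leq1 _) _; apply: ltnW.
split; rewrite ?size_polyDl //; first exact: ltnW.
  by rewrite monicE lead_coefDl // -monicE.
have /negPf pos : (size al).-2 != 0%N by rewrite -lt0n -!subn1 !subn_gt0; lia.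
by rewrite coefD al0 coefC pos addr0.
Qed.

Lemma psubst_addC (al : {poly R[i]}) c E :
  psubst (al + c%:P) E = psubst al E + c%:P%:P.
Proof. by rewrite /psubst rmorphD /= map_polyC comp_polyD comp_polyC. Qed.

(** In a row with y-degree j >= (a-1) n / a the remainder has x-degree less than
(a-1) m / a, while the exponent of X + 1 dividing it is
j - (n - m) (a-1) / a >= (a-1) m / a, so the row vanishes. *)
Lemma low_remainder a b m n F (al : {poly R[i]}) :
  calQ a b m n -> cond1to3 m n F -> TF a m n F al ->
  DC01 m n (F - psubst al (Fgen a m n F)) (bound a m n) ->
  forall i j, (F - psubst al (Fgen a m n F))`_i`_j != 0 ->
  (a * j < a.-1 * n)%N.
Proof.
move=> Q condF TFal dc i j nz; rewrite ltnNge; apply/negP => lej.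
have sup := remainder_support Q condF TFal.
case: Q => [[a_gt0 _ m_gt0 _] ltmn /andP[dvdm dvdn] _ _].
have [m1 mE] := dvdnP dvdm; have [n1 nE] := dvdnP dvdn.
have mn : (0 < m < n)%N by rewrite m_gt0.
have flE : (bound a m n %/ m = (n1 - m1) * a.-1)%N.
  rewrite (_ : bound a m n = (n1 - m1) * a.-1 * m)%N ?mulnK //.
  rewrite (boundE _ a_gt0 dvdm) mE nE mulnK // -mulnBl; lia.
have := floor01E (bound a m n) mn; rewrite flE => fl.
have /(_ j) := (DC01E _ fl).1 dc.
move/(dvd_small_eq0 (monic_X1 R) (size_X1 R)) => row0.
move/eqP: nz; apply; rewrite -coef_swapXY row0 ?coef0 //.
apply/leq_sizeP => i' le'; rewrite coef_swapXY.
apply: contrapT => /eqP /sup [_ _]; apply; split=> //.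
have le_a : (j - (n1 - m1) * a.-1 <= i')%N := le'.
have : (a * (j - (n1 - m1) * a.-1) <= a * i')%N by rewrite leq_mul2l le_a orbT.
apply: leq_trans; rewrite mulnBr.
move: lej ltmn; rewrite nE mE.
have -> : (a * ((n1 - m1) * a.-1) = a.-1 * (n1 * a) - a.-1 * (m1 * a))%N.
  by rewrite -mulnBr -mulnBl; lia.
move=> lej; rewrite ltn_pmul2r // => lt1.
have : (a.-1 * (m1 * a) <= a.-1 * (n1 * a))%N.
  by rewrite leq_mul // leq_mul // ltnW.
lia.
Qed.

(** a divides n - m, so n - m >= 2; this makes floor ((i + 1) m eps) equal to m at
i = m (n - m) and to 0 at i = 0. *)
Lemma gap_gt1 a b m n : calQ a b m n -> (m.+1 < n)%N.
Proof.
case=> _ ltmn /andP[dvdm dvdn] _ /andP[a_gt1 _].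
have : (a %| n - m)%N by rewrite dvdn_sub.
by move/dvdn_leq; rewrite subn_gt0 => /(_ ltmn); lia.
Qed.

(** The constant remainder c is absorbed into alpha; the polygon of the new
remainder 0 is empty, hence contained in the minimal one. *)
Lemma remainder_eq0 a b m n F (al : {poly R[i]}) :
  calQ a b m n -> cond1to3 m n F -> TF a m n F al ->
  minimal_in (VF a m n F) (N0 (F - psubst al (Fgen a m n F))) ->
  DC m n (F - psubst al (Fgen a m n F)) 0 ->
  F - psubst al (Fgen a m n F) = 0.
Proof.
move=> Q condF TFal [_ minV] dc0.
have [k [m' [n' [[al_monic size_al le_ak] _ _ _ _]]]] :=
  generator_shape Q condF TFal.
have [[_ _ m_gt0 _] ltmn /andP[dvdm dvdn] _ /andP[a_gt1 _]] := Q.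
have [c remC] : exists c, F - psubst al (Fgen a m n F) = c%:P%:P.
  by eexists; exact: DC0_constant m_gt0 (gap_gt1 Q) dc0.
have rem0 : F - psubst (al + c%:P) (Fgen a m n F) = 0.
  by rewrite psubst_addC opprD addrA remC subrr.
apply: N0_eq0; symmetry; apply: minV; last exact: sub0set.
exists (al + c%:P); last by rewrite rem0 N00.
split; last by move=> q [i [j []]]; rewrite rem0 !coef0 eqxx.
by apply: bbT_addC; [rewrite size_al; apply: leq_trans a_gt1 le_ak | case: TFal].
Qed.

End Descent.

Theorem lemma3p7 (R : realType)
    (ao : nat -> nat -> nat -> nat -> {poly {poly R[i]}} -> {poly R[i]})
    (hao : minimal_choice ao) :
  assertionD ao -> assertionC ao.
Proof.
move=> D a b m n F G Q condFG.
have [dc01 dc11 dsc] := D a b m n F G Q condFG.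
have [condF _ _] := condFG.
have [TFal minV] := hao a b m n F Q condF.
have [[_ _ m_gt0 _] ltmn /andP[dvdm dvdn] _ /andP[a_gt1 _]] := Q.
have mn : (0 < m < n)%N by rewrite m_gt0.
have le_bound : (bound a m n <= m * (n - m))%N.
  rewrite /bound -[X in (_ <= X)%N](mulnK _ (ltnW a_gt1)).
  by rewrite leq_div2r // leq_mul // leq_subr.
have start01 : DC01 m n (Frem ao a b m n F) (m * (n - m)).
  apply/(DC01E _ (floor01E _ mn)); rewrite mulKn //.
  exact: remainder_row01 Q condF TFal.
have bound01 : DC01 m n (Frem ao a b m n F) (bound a m n).
  apply: (descend le_bound start01) => i lei; apply: dc01; lia.
have start11 : DC11 m n (Frem ao a b m n F) (m * (n - m)).
  apply/(DC11E _ (floor11E _ mn)).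
  have -> : ((m * (n - m)).+1 %/ (n - m) = m)%N.
    rewrite -addn1 divnMDl ?divn_small ?addn0 //; last by rewrite subn_gt0.
    by have := gap_gt1 Q; lia.
  apply: (remainder_row11 Q condF TFal).
  exact: low_remainder Q condF TFal bound01.
have bound11 : DC11 m n (Frem ao a b m n F) (bound a m n).
  apply: (descend le_bound start11) => i lei; apply: dc11; lia.
have dc0 : DC m n (Frem ao a b m n F) 0.
  apply: (descend (leq0n (bound a m n))); first by [].
  by move=> i lei dci; apply: dsc; [lia | apply: DC_DSC].
have rem0 : Frem ao a b m n F = 0 by exact: remainder_eq0 Q condF TFal minV dc0.
have V0 : Vmin ao a b m n F = classical_sets.set0 by rewrite /Vmin rem0 N00.
split=> //; first by rewrite -V0; case: minV.
by exists (ao a b m n F) => //; case: TFal.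
Qed.
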